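(* Let $n\ge 2$, let $d=[\Delta_1,\dots,\Delta_n]^\top$ with all $\Delta_i>0$, let $\Delta=\Delta_1\Delta_2\cdots\Delta_n$, and let $x^0\in\mathbb{R}^n$. Let $f:\operatorname{dom} f\subseteq\mathbb{R}^n\to\mathbb{R}$ be continuous ($\mathcal{C}^0$) on an open domain containing the hyperrectangle $R(x^0;d)\subseteq\operatorname{dom} f$. For each $(N_1,\dots,N_n)$ with all $N_i\ge 2$, let $S\in\mathbb{R}^{n\times N}$, $N=N_1\cdots N_n$, be a matrix of directions selecting one arbitrary sample point in each cell of the grid on $R(x^0;d)$ (as defined in the context). Then $$\lim_{\vec N\to\vec\infty}\nabla_s f(x^0;S)=\Delta^{-1}L_nT_n,$$ where $L_n\in\mathbb{R}^{n\times n}$ has entries $$[L_n]_{i,i}=\frac{12(3n-2)}{\Delta_i^2(3n+1)},\qquad [L_n]_{i,j}=\frac{-36}{\Delta_i\Delta_j(3n+1)}\quad(i\ne j),$$ and $T_n\in\mathbb{R}^n$ has entries $$[T_n]_i=\int_{R(0;d)}x_i\left(f(x^0+x)-f(x^0)\right)dx,\qquad i\in\{1,\dots,n\}.$$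
   Context: For $d=[\Delta_1,\dots,\Delta_n]^\top$ with positive entries, $R(x^0;d)=\prod_{i=1}^n[x^0_i,x^0_i+\Delta_i]$ (so $x^0$ is its leftmost vertex) and $R(0;d)=\prod_{i=1}^n[0,\Delta_i]$. Given integers $N_1,\dots,N_n\ge 2$, put $N=N_1\cdots N_n$, $\overline{\Delta}_i=\Delta_i/N_i$, $\overline D=\operatorname{diag}[\overline\Delta_1,\dots,\overline\Delta_n]$. For $\vec z=(z_2,\dots,z_n)$ with $z_k\in\{1,\dots,N_k\}$, let $B_R^{\vec z}\in\mathbb{R}^{n\times N_1}$ be the matrix whose $j$-th column is $\overline D\,[j,z_2,z_3,\dots,z_n]^\top$, $j=1,\dots,N_1$, and let $B_M^{\vec z}=\overline D\,\ddot B_M^{\vec z}$ where $\ddot B_M^{\vec z}\in\mathbb{R}^{n\times N_1}$ is an arbitrary matrix with all entries in $[0,1]$. Let $B^{\vec z}=B_R^{\vec z}-B_M^{\vec z}$. The matrix $S\in\mathbb{R}^{n\times N}$ is the concatenation of the blocks $B^{\vec z}$ over all $\vec z$, ordered from $(1,\dots,1,1),(1,\dots,1,2),\dots$ to $(N_2,\dots,N_n)$. Thus $S$ depends on $(N_1,\dots,N_n)$ and on the arbitrary choices of $\ddot B_M^{\vec z}$. For a matrix $S\in\mathbb{R}^{n\times N}$ with columns $Se_j$ such that $x^0+Se_j\in\operatorname{dom} f$, the generalized simplex gradient (GSG) is $\nabla_sf(x^0;S)=(S^\dagger)^\top\delta_f(x^0;S)$, where $S^\dagger$ is the Moore--Penrose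 pseudoinverse and $\delta_f(x^0;S)=[f(x^0+Se_1)-f(x^0),\dots,f(x^0+Se_N)-f(x^0)]^\top\in\mathbb{R}^N$. $\lim_{\vec N\to\vec\infty}$ denotes the limit as $N_1\to\infty,\dots,N_n\to\infty$ jointly (each $N_i$ tends to infinity, not necessarily at the same speed). *)

(* Defs.v *)
From HB Require Import structures.
From mathcomp Require Import all_boot all_order all_algebra.
From mathcomp Require Import all_classical all_reals all_analysis.
Set Implicit Arguments.
Unset Strict Implicit.
Unset Printing Implicit Defensive.
Import Order.TTheory GRing.Theory Num.Theory.
Import numFieldNormedType.Exports.
Local Open Scope classical_set_scope.
Local Open Scope ring_scope.

Section moore_penrose.
Context {R : realFieldType} {m p : nat}.
Implicit Types (A : 'M[R]_(m, p)) (X : 'M[R]_(p, m)).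

Definition is_moore_penrose A X : Prop :=
  [/\ A *m X *m A = A, X *m A *m X = X,
      (A *m X)^T = A *m X & (X *m A)^T = X *m A].

Definition moore_penrose A : 'M[R]_(p, m) := xget 0 [set X | is_moore_penrose A X].

Lemma is_moore_penrose_uniq A X Y :
  is_moore_penrose A X -> is_moore_penrose A Y -> X = Y.
Proof.
move=> [X1 X2 X3 X4] [Y1 Y2 Y3 Y4].
have AXY : A *m X = A *m Y.
  rewrite -X3 -[in LHS]Y1 -!mulmxA mulmxA trmx_mul X3 Y3.
  by rewrite !mulmxA X1.
have XAY : X *m A = Y *m A.
  by rewrite -X4 -[in LHS]Y1 -mulmxA mulmxA trmx_mul X4 Y4 -!mulmxA (mulmxA A) X1.
by rewrite -X2 XAY -mulmxA AXY mulmxA Y2.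
Qed.

End moore_penrose.

Section moore_penrose_existence.
Context {R : realFieldType}.

Lemma row_free_gram_unitmx r p (F : 'M[R]_(r, p)) :
  row_free F -> F *m F^T \in unitmx.
Proof.
move=> Ffree; rewrite -row_free_unit -kermx_eq0.
apply/eqP/row_matrixP => i; rewrite row0; set v := row i _.
have vFF : v *m (F *m F^T) = 0.
  by apply/sub_kermxP; rewrite row_sub.
suff vF0 : v *m F = 0.
  by apply/eqP; rewrite -(mulmx_free_eq0 _ Ffree) vF0.
have w0 : (v *m F) *m (v *m F)^T = 0.
  by rewrite trmx_mul mulmxA -(mulmxA v) vFF mul0mx.
apply/rowP => j; rewrite [RHS]mxE; apply/eqP; rewrite -sqrf_eq0.
move/matrixP: w0 => /(_ 0 0); rewrite mxE [RHS]mxE => /eqP.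
rewrite psumr_eq0; last by move=> k _; rewrite [X in _ * X]mxE -expr2 sqr_ge0.
by move=> /allP/(_ j (mem_index_enum _)); rewrite /= [X in _ * X]mxE -expr2.
Qed.

Let moore_penrose_factor m p r (C : 'M[R]_(m, r)) (F : 'M[R]_(r, p)) :
  row_free C^T -> row_free F ->
  is_moore_penrose (C *m F)
    (F^T *m invmx (F *m F^T) *m invmx (C^T *m C) *m C^T).
Proof.
move=> /row_free_gram_unitmx; rewrite trmxK => GC /row_free_gram_unitmx GF.
set U := invmx (F *m F^T); set V := invmx (C^T *m C); set X := _ *m C^T.
have FU : F *m F^T *m U = 1%:M by rewrite mulmxV.
have VC : V *m C^T *m C = 1%:M by rewrite -mulmxA mulVmx.
have UT : U^T = U by rewrite /U trmx_inv trmx_mul trmxK.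
have VT : V^T = V by rewrite /V trmx_inv trmx_mul trmxK.
have AX : C *m F *m X = C *m V *m C^T.
  by rewrite /X !mulmxA -2!(mulmxA C) FU mulmx1.
have XA : X *m (C *m F) = F^T *m U *m F.
  by rewrite /X !mulmxA -2!(mulmxA (F^T *m U)) VC mulmx1.
split; rewrite ?AX ?XA.
- by rewrite !mulmxA -2!(mulmxA C) VC mulmx1.
- by rewrite /X !mulmxA -2!(mulmxA (F^T *m U)) FU mulmx1.
- by rewrite !trmx_mul trmxK VT mulmxA.
- by rewrite !trmx_mul trmxK UT mulmxA.
Qed.

Lemma moore_penroseP m p (A : 'M[R]_(m, p)) :
  is_moore_penrose A (moore_penrose A).
Proof.
rewrite /moore_penrose; apply: (@xgetPex _ 0 [set X | is_moore_penrose A X]).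
rewrite -(mulmx_base A); eexists; apply: moore_penrose_factor.
  by rewrite -row_leq_rank mxrank_tr; have := col_base_full A;
    rewrite /row_full => /eqP ->.
exact: row_base_free.
Qed.

End moore_penrose_existence.

(** The Lebesgue measure on R^n. Tuples are used because they carry the product
    sigma-algebra in the library. *)
Section lebesgue_tuple.
Context {R : realType}.
Local Notation RR := (measurableTypeR R).
Local Open Scope ereal_scope.

Definition tuple_cons n (u : RR * n.-tuple RR) : n.+1.-tuple RR :=
  [tuple of u.1 :: u.2].

Fixpoint lebesgue_tuple (n : nat) : set (n.-tuple RR) -> \bar R :=
  match n with
  | 0 => \d_ [tuple]
  | n'.+1 => pushforward (@lebesgue_measure R \x @lebesgue_tuple n')
               (@tuple_cons n')
  end.

Let measurable_tuple_cons n : measurable_fun setT (@tuple_cons n).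
Proof. exact: measurable_cons. Qed.

Section step.
Variables (n : nat) (m2 : {sigma_finite_measure set (n.-tuple RR) -> \bar R}).

Let step := pushforward (@lebesgue_measure R \x m2) (@tuple_cons n).

Let step0 : step set0 = 0.
Proof. by rewrite /step /pushforward preimage_set0 measure0. Qed.

Let step_ge0 A : 0 <= step A.
Proof. rewrite /step /pushforward; exact: measure_ge0. Qed.

Let step_sigma_additive : semi_sigma_additive step.
Proof.
move=> F mF tF mUF; rewrite /step /pushforward preimage_bigcup.
apply: measure_semi_sigma_additive.
- by move=> k; rewrite -[X in measurable X]setTI; exact: measurable_tuple_cons.
- apply/trivIsetP => /= i j _ _ ij; rewrite -preimage_setI.
  by move/trivIsetP : tF => /(_ _ _ _ _ ij) ->//; rewrite preimage_set0.
- rewrite -preimage_bigcup -[X in measurable X]setTI.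
  exact: measurable_tuple_cons.
Qed.

HB.instance Definition _ :=
  isMeasure.Build _ _ _ step step0 step_ge0 step_sigma_additive.

Let step_sigma_finite : sigma_finite setT step.
Proof.
have [F FT Ffin] : sigma_finite setT (@lebesgue_measure R \x m2).
  have /sigma_finiteP[F [TF ndF Foo]] := sigma_finiteT (@lebesgue_measure R).
  have /sigma_finiteP[G [TG ndG Goo]] := sigma_finiteT m2.
  exists (fun k => F k `*` G k).
    rewrite -setXTT TF TG; apply/seteqP; split=> [[x y]|[x y]].
      move=> [/= [k _ Fkx] [l _ Gly]]; exists (maxn k l) => //; split.
      - by move: x Fkx; exact/subsetPset/ndF/leq_maxl.
      - by move: y Gly; exact/subsetPset/ndG/leq_maxr.
    by move=> [k _ []/= ? ?]; split; exists k.
  move=> k; have [? ?] := Foo k; have [? ?] := Goo k.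
  split; first exact: measurableX.
  by rewrite product_measure1E// lte_mul_pinfty// ge0_fin_numE.
pose g (t : n.+1.-tuple RR) : RR * n.-tuple RR := (thead t, [tuple of behead t]).
have gK : cancel (@tuple_cons n) g.
  by move=> [x t]; rewrite /g /tuple_cons theadE /=; congr pair; exact/val_inj.
have mg : measurable_fun setT g.
  apply: measurable_fun_pair; last exact: measurable_behead.
  exact: measurable_tnth.
exists (fun k => g @^-1` F k).
  by rewrite -preimage_bigcup -FT preimage_setT.
move=> k; have [mF Foo] := Ffin k; split.
  by rewrite -[X in measurable X]setTI; exact: mg.
rewrite /step /pushforward -comp_preimage.
by rewrite (_ : g \o @tuple_cons n = id)//; apply/funext.
Qed.

HB.instance Definition _ :=
  Measure_isSigmaFinite.Build _ _ _ step step_sigma_finite.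

Definition lebesgue_tuple_step :
  {sigma_finite_measure set (n.+1.-tuple RR) -> \bar R} := step.

End step.

Let lebesgue_tuple_sigma_finite_measure n :
  exists mu : {sigma_finite_measure set (n.-tuple RR) -> \bar R},
    @lebesgue_tuple n = mu.
Proof.
elim: n => [|n [mu IH]]; first by eexists (\d_ _).
by exists (lebesgue_tuple_step mu); rewrite /= IH.
Qed.

Let lebesgue_tuple0 n : @lebesgue_tuple n set0 = 0.
Proof.
by have [mu ->] := lebesgue_tuple_sigma_finite_measure n; rewrite measure0.
Qed.

Let lebesgue_tuple_ge0 n A : 0 <= @lebesgue_tuple n A.
Proof. by have [mu ->] := lebesgue_tuple_sigma_finite_measure n. Qed.

Let lebesgue_tuple_sigma_additive n : semi_sigma_additive (@lebesgue_tuple n).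
Proof.
have [mu ->] := lebesgue_tuple_sigma_finite_measure n.
exact: measure_semi_sigma_additive.
Qed.

HB.instance Definition _ n := isMeasure.Build _ _ _ (@lebesgue_tuple n)
  (@lebesgue_tuple0 n) (@lebesgue_tuple_ge0 n)
  (@lebesgue_tuple_sigma_additive n).

Let lebesgue_tuple_sigma_finite n : sigma_finite setT (@lebesgue_tuple n).
Proof.
by have [mu ->] := lebesgue_tuple_sigma_finite_measure n; exact: sigma_finiteT.
Qed.

HB.instance Definition _ n := Measure_isSigmaFinite.Build _ _ _
  (@lebesgue_tuple n) (@lebesgue_tuple_sigma_finite n).

Lemma lebesgue_tuple_box n (A : 'I_n -> set RR) :
  (forall i, measurable (A i)) ->
  lebesgue_tuple [set t | forall i, A i (tnth t i)] =
  \prod_(i < n) lebesgue_measure (A i).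
Proof.
elim: n A => [|n IH] A mA.
  rewrite big_ord0 /= diracE mem_set//; by case.
rewrite big_ord_recl -IH//= /pushforward.
have [mu muE] := lebesgue_tuple_sigma_finite_measure n; rewrite muE.
rewrite -product_measure1E//; last first.
  rewrite (_ : [set _ | _] = \bigcap_(i in [set: 'I_n])
      ((fun t : n.-tuple RR => tnth t i) @^-1` A (lift ord0 i))).
    apply: fin_bigcap_measurable => // i _; rewrite -[X in measurable X]setTI.
    exact: measurable_tnth.
  apply/seteqP; split => t /= At i; first by move=> _; exact: At.
  exact: (At i I).
congr (_ _); apply/seteqP; split => -[x t] /=.
  move=> At; split; first exact: (At ord0).
  by move=> i; have := At (lift ord0 i); rewrite tnthS.
move=> [Ax At] i; case: (unliftP ord0 i) => [j ->|->]; last exact: Ax.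
by rewrite tnthS; exact: At.
Qed.

End lebesgue_tuple.

Section gsg.
Context {R : realType} {n : nat}.
Implicit Types (f : 'cV[R]_n -> R) (d : 'cV[R]_n).

Definition hyperrectangle (x0 : 'cV[R]_n) d : set 'cV[R]_n :=
  [set x | forall i, x0 i 0 <= x i 0 <= x0 i 0 + d i 0].

Definition delta f (x0 : 'cV[R]_n) p (S : 'M[R]_(n, p)) : 'cV[R]_p :=
  \col_j (f (x0 + col j S) - f x0).

Definition gsg f (x0 : 'cV[R]_n) p (S : 'M[R]_(n, p)) : 'cV[R]_n :=
  (moore_penrose S)^T *m delta f x0 S.

Section sample_matrix.
Variables (d : 'cV[R]_n) (N : 'I_n -> nat).

(** The columns run through the blocks z = (z_2, ..., z_n) in lexicographic
    order (z_n varies fastest), and inside a block j = z_1 runs from 1 to N_1.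
    Hence the 0-based column c is j' + N_1 * (z'_n + N_n * (z'_(n-1) + ...)),
    with j' = j - 1 and z'_k = z_k - 1, and [grid_index c i] is z'_(i+1). *)
Definition grid_index (c : nat) (i : 'I_n) : nat :=
  ((if i == 0 :> nat then c
    else c %/ \prod_(k < n | (k == 0 :> nat) || (i < k)%N) N k) %% N i)%N.

Definition cell_lengths : 'M[R]_n := diag_mx (\row_i (d i 0 / (N i)%:R)).

Definition right_endpoints : 'M[R]_(n, (\prod_i N i)%N) :=
  cell_lengths *m \matrix_(i, c) (grid_index c i).+1%:R.

(** [M] is the concatenation, in the same order, of the arbitrary matrices with
    entries in [0, 1] that are attached to the blocks. *)
Definition sample_matrix (M : 'M[R]_(n, (\prod_i N i)%N)) :
  'M[R]_(n, (\prod_i N i)%N) := right_endpoints - cell_lengths *m M.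

Lemma sample_matrixE (M : 'M[R]_(n, (\prod_i N i)%N)) i c :
  sample_matrix M i c =
    d i 0 / (N i)%:R * ((grid_index c i).+1%:R - M i c).
Proof.
by rewrite /sample_matrix /right_endpoints -mulmxBr mul_diag_mx !mxE.
Qed.

Lemma sample_matrix_mem x0 (M : 'M[R]_(n, (\prod_i N i)%N)) :
  (forall i, 0 < d i 0) -> (forall i, (0 < N i)%N) ->
  (forall i c, 0 <= M i c <= 1) ->
  forall c, hyperrectangle x0 d (x0 + col c (sample_matrix M)).
Proof.
move=> d0 N0 M01 c i; have /andP[m0 m1] := M01 i c.
have Ni0 : 0 < (N i)%:R :> R by rewrite ltr0n.
have gN : (grid_index c i).+1%:R <= (N i)%:R :> R by rewrite ler_nat ltn_pmod.
have -> : (x0 + col c (sample_matrix M)) i 0 = x0 i 0 + sample_matrix M i c.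
  by rewrite mxE [col _ _ _ _]mxE.
rewrite sample_matrixE lerDl lerD2l; apply/andP; split.
  apply: mulr_ge0; first by rewrite divr_ge0// ltW.
  by rewrite subr_ge0 (le_trans m1)// ler1n.
rewrite -mulrA ler_piMr ?(ltW (d0 i))// mulrC ler_pdivrMr// mul1r.
by rewrite lerBlDr (le_trans gN)// lerDl.
Qed.

End sample_matrix.

Definition mx_L d : 'M[R]_n := \matrix_(i, j)
  if i == j then 12 * (3 * n%:R - 2) / (d i 0 ^+ 2 * (3 * n%:R + 1))
  else - 36 / (d i 0 * d j 0 * (3 * n%:R + 1)).

Definition col_of_tuple (t : n.-tuple (measurableTypeR R)) : 'cV[R]_n :=
  \col_k tnth t k.

Definition vec_T f (x0 : 'cV[R]_n) d : 'cV[R]_n := \col_i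
  \int[@lebesgue_tuple R n]_(t in col_of_tuple @^-1` hyperrectangle 0 d)
    (col_of_tuple t i 0 * (f (x0 + col_of_tuple t) - f x0)).

End gsg.

(** All the N_i tend to infinity jointly, with no relation between them. *)
Definition all_oo (n : nat) : set_system ('I_n -> nat) :=
  filter_from setT (fun m : nat => [set N | forall i, (m <= N i)%N]).

Global Instance all_oo_proper n : ProperFilter (@all_oo n).
Proof.
apply: filter_from_proper => [|m _]; last by exists (fun=> m) => i /=.
apply: filter_from_filter; first by exists 0%N.
move=> a b _ _; exists (maxn a b) => // N /= abN.
by split=> i; apply: leq_trans (abN i); rewrite ?leq_maxl ?leq_maxr.
Qed.

(* Main.v *)
Require Import Defs.
From mathcomp Require Import all_boot all_order all_algebra.
From mathcomp Require Import all_classical all_reals all_analysis.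
From mathcomp Require Import measurable_realfun.
From mathcomp Require Import ring lra.
Set Implicit Arguments.
Unset Strict Implicit.
Unset Printing Implicit Defensive.
Import Order.TTheory GRing.Theory Num.Theory.
Import numFieldNormedType.Exports.
Local Open Scope classical_set_scope.
Local Open Scope ring_scope.

(** For every matrix S the vector [gsg f x0 S] solves the normal equations
    S S^T g = S delta, because S S^+ S = S and S^+ S is symmetric. After division
    by the number of columns both coefficients become averages over one sample
    point per cell of the grid:
      - the entries of S S^T / N average x_i x_j, and
      - the entries of S delta / N average x_i (f (x0 + x) - f x0).
    All cells have the same volume, so these averages are Riemann sums divided by
    the volume of the box; the integrands are continuous, hence the sums converge
    to the mean values over the box, whichever points are sampled
    ([riemann_sum_cvg]).

    The mean of x_i x_j is d_i d_j / 4 off the diagonal and d_i^2 / 3 on it. The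
    limit being independent of the sample points, it is computed on the cell
    centres, where the average factors into sums of powers along the axes
    ([gram_midpoint_cvg]). The resulting matrix is D (J / 4 + 1 / 12) D with D the
    diagonal matrix of d and J the all-ones matrix, and [mx_L d] is its inverse.
    Finally, the solutions of linear systems with converging coefficients converge
    when the limit matrix is invertible ([cvg_linear_system]).

    Two points need care. The columns are numbered by a mixed-radix expansion, so
    that averaging over columns is averaging over all multi-indices
    ([grid_index_inj]). The integrands are measurable for the product
    sigma-algebra on tuples because they are pointwise limits of step functions on
    finer and finer grids. *)

(** * Columns and multi-indices *)

Lemma eq_modn_mul (a b m k : nat) :
  (a = b %[mod m] -> a %/ m = b %/ m %[mod k] -> a = b %[mod m * k])%N.
Proof.
move=> ab qab; have aux (c : nat) : (c %% (m * k) = (c %/ m) %% k * m + c %% m)%N.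
  rewrite [in RHS]modn_divl {1}(divn_eq (c %% (m * k)) m).
  by rewrite modn_dvdm ?dvdn_mulr// [(m * k)%N]mulnC.
by rewrite !aux ab qab.
Qed.

Section grid_index.
Variables (n : nat) (N : 'I_n -> nat).

(** [grid_index] lists the digits of a mixed-radix expansion whose lowest digit
    belongs to axis 0 and the next ones to the axes n-1, n-2, ..., 1. Reading
    them in that order determines the column modulo larger and larger partial
    products, the last of which exceeds every column number. *)
Lemma grid_index_inj (a b : nat) :
  (a < \prod_i N i)%N -> (b < \prod_i N i)%N ->
  (forall i, grid_index N a i = grid_index N b i) -> a = b.
Proof.
case: n N => [|n'] N'.
  by rewrite !big_ord0 !ltnS !leqn0 => /eqP-> /eqP->.
move=> a_lt b_lt ab.
(* The place value of the digit of axis [m], for [m] positive; [W 0] is the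
   total number of columns. *)
pose W m := (\prod_(k < n'.+1 | (k == 0 :> nat) || (m < k)) N' k)%N.
have eqW r m : (m + r = n')%N -> a = b %[mod W m].
  elim: r m => [m|r IH m mr].
    rewrite addn0 /W => ->; rewrite (eq_bigl (pred1 ord0)) ?big_pred1_eq.
      exact: (ab ord0).
    by move=> k; rewrite [(n' < k)%N]ltnNge -ltnS ltn_ord orbF.
  have mn : (m.+1 < n'.+1)%N by rewrite ltnS -mr -addSnnS leq_addr.
  have -> : W m = (W m.+1 * N' (Ordinal mn))%N.
    rewrite /W (bigD1 (Ordinal mn)) ?ltnSn ?orbT//= mulnC; congr muln.
    apply: eq_bigl => k; rewrite -val_eqE /=.
    by case: (ltngtP m.+1 k) => [|| <-]; rewrite ?andbT ?andbF ?orbF//;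
       case: eqP => // ->.
  apply: eq_modn_mul; first by apply: IH; rewrite addSnnS.
  exact: (ab (Ordinal mn)).
have := eqW n' 0 (add0n _); rewrite /W.
rewrite (eq_bigl predT) => [|k]; last by rewrite lt0n orbN.
by rewrite !modn_small.
Qed.

Lemma grid_index_lt c i : (0 < N i)%N -> (grid_index N c i < N i)%N.
Proof. exact: ltn_pmod. Qed.

Hypothesis N_gt0 : forall i, (0 < N i)%N.

Let multi_index : 'I_(\prod_i N i)%N -> fprod (fun i => 'I_(N i)) :=
  fun c => [fprod i => Ordinal (grid_index_lt c (N_gt0 i))].

Let multi_index_bij : bijective multi_index.
Proof.
apply: inj_card_bij => [a b ab|].
  apply/val_inj/grid_index_inj => [||i]; [exact: ltn_ord..|].
  by have /(congr1 (fun t : fprod _ => val (t i))) := ab; rewrite !fprodE.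
by rewrite card_fprod card_ord; under eq_bigr do rewrite card_ord.
Qed.

Lemma grid_index_surj (z : 'I_n -> nat) : (forall i, z i < N i)%N ->
  exists c : 'I_(\prod_i N i)%N, forall i, grid_index N c i = z i.
Proof.
move=> zN; case: multi_index_bij => g _ gK.
pose t : fprod (fun i => 'I_(N i)) := [fprod i => Ordinal (zN i)].
exists (g t) => i.
have /(congr1 (fun t : fprod _ => val (t i))) := gK t.
by rewrite !fprodE.
Qed.

(** Every multi-index is met by exactly one column, so a sum over the columns
    of a product over the axes distributes. *)
Lemma sum_grid_prod (R : comPzSemiRingType) (P : 'I_n -> nat -> R) :
  \sum_(c < (\prod_i N i)%N) \prod_i P i (grid_index N c i) =
  \prod_i \sum_(k < N i) P i k.
Proof.
pose F i : {ffun 'I_(N i) -> R} := [ffun k : 'I_(N i) => P i k].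
transitivity (\sum_(t : fprod (fun i => 'I_(N i))) \prod_i F i (t i)).
  rewrite (reindex _ (onW_bij _ multi_index_bij)).
  by apply: eq_bigr => c _; apply: eq_bigr => i _; rewrite fprodE ffunE.
rewrite big_fprod; under [RHS]eq_bigr => i _.
  rewrite (eq_bigr (fun k => F i k)); last by move=> k _; rewrite ffunE.
  rewrite (big_tag (fun i (k : 'I_(N i)) => F i k)).
  over.
exact/esym/(bigA_distr_big_dep (fun i => tagged_with (fun i => 'I_(N i)) i)).
Qed.

End grid_index.

(** * The cells of the grid *)

(** The closed left end of the initial interval makes the pieces partition
    the closed segment, so that no null set has to be discarded. *)
Definition grid_itv (R : realType) (h : R) (k : nat) : set R :=
  [set` Interval (BSide (k == 0)%N (k%:R * h)) (BRight (k.+1%:R * h))].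

Section grid_itv.
Context {R : realType}.
Variables (h : R) (h_gt0 : 0 < h).

Lemma grid_itvP k x : grid_itv h k x ->
  [/\ k%:R * h <= x, x <= k.+1%:R * h & (0 < k)%N -> k%:R * h < x].
Proof.
rewrite /grid_itv /= itv_boundlr => /andP[kx xk]; split.
- by move: kx; case: (k == 0)%N; rewrite bnd_simp// => /ltW.
- by move: xk; rewrite bnd_simp.
- by case: k kx {xk} => // k; rewrite bnd_simp.
Qed.

Lemma lebesgue_measure_grid_itv k :
  lebesgue_measure (grid_itv h k : set (measurableTypeR R)) = h%:E.
Proof.
rewrite /grid_itv lebesgue_measure_itv /= lte_fin ltr_pM2r// ltr_nat ltnSn.
by rewrite -EFinD -mulrBl -natrB// subSnn mul1r.
Qed.

Lemma grid_itv_disjoint k l x : grid_itv h k x -> grid_itv h l x -> k = l.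
Proof.
wlog kl : k l / (k <= l)%N => [W|].
  by case: (leqP k l) => [|/ltnW] /W H ? ?; [exact: H|apply/esym; exact: H].
move=> /grid_itvP[_ xk _] /grid_itvP[_ _ lx].
move: kl; rewrite leq_eqVlt => /predU1P[//|kl].
have := lt_le_trans (lx (leq_ltn_trans (leq0n _) kl)) xk.
by rewrite ltr_pM2r// ltr_nat ltnNge kl.
Qed.

Lemma grid_itv_cover m x : (0 < m)%N -> 0 <= x <= m%:R * h ->
  exists2 k, (k < m)%N & grid_itv h k x.
Proof.
move=> m_gt0 /andP[x0 xm].
have xP : exists k, x <= k.+1%:R * h by exists m.-1; rewrite prednK.
case: (ex_minnP xP) => k xk kmin; exists k.
  by rewrite -(prednK m_gt0) ltnS kmin// prednK.
rewrite /grid_itv /= itv_boundlr bnd_simp xk andbT.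
case: k xk kmin => [|k] xk kmin; rewrite bnd_simp ?mul0r//.
by rewrite ltNge; apply/negP => /kmin; rewrite ltnn.
Qed.

End grid_itv.

Section cells.
Context {R : realType} {n : nat}.
Variables (d : 'cV[R]_n) (N : 'I_n -> nat).
Hypotheses (d_gt0 : forall i, 0 < d i 0) (N_gt0 : forall i, (0 < N i)%N).
Local Notation RR := (measurableTypeR R).
Local Notation box := (col_of_tuple @^-1` hyperrectangle 0 d : set (n.-tuple RR)).

Definition cell (c : nat) : set (n.-tuple RR) :=
  [set t | forall i, grid_itv (d i 0 / (N i)%:R) (grid_index N c i) (tnth t i)].

Let h_gt0 i : 0 < d i 0 / (N i)%:R. Proof. by rewrite divr_gt0// ltr0n. Qed.

Lemma boxE : box = [set t | forall i, `[0, d i 0]%classic (tnth t i)].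
Proof.
by apply/seteqP; split => t /= H i; have := H i;
   rewrite /= !mxE add0r in_itv.
Qed.

Lemma measurable_tuple_box (A : 'I_n -> set RR) :
  (forall i, measurable (A i)) ->
  measurable [set t : n.-tuple RR | forall i, A i (tnth t i)].
Proof.
move=> mA; rewrite (_ : [set _ | _] = \bigcap_(i in [set: 'I_n])
    ((fun t : n.-tuple RR => tnth t i) @^-1` A i)).
  apply: fin_bigcap_measurable => // i _; rewrite -[X in measurable X]setTI.
  exact: measurable_tnth.
by apply/seteqP; split => t /= At i; [move=> _|]; exact: At.
Qed.

Lemma measurable_box : measurable box.
Proof.
rewrite boxE; apply: (@measurable_tuple_box (fun i => `[0, d i 0]%classic)) => i.
exact: measurable_itv.
Qed.

Lemma lebesgue_box : lebesgue_tuple box = (\prod_i d i 0)%:E.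
Proof.
rewrite boxE (@lebesgue_tuple_box _ _ (fun i => `[0, d i 0]%classic)).
  2: by move=> i; exact: measurable_itv.
rewrite -prodEFin; apply: eq_bigr => i _.
by rewrite lebesgue_measure_itv /= lte_fin d_gt0 oppr0 adde0.
Qed.

Lemma measurable_cell c : measurable (cell c).
Proof.
apply: (@measurable_tuple_box
  (fun i => grid_itv (d i 0 / (N i)%:R) (grid_index N c i))) => i.
exact: measurable_itv.
Qed.

(** That all cells have the same volume is what turns the plain average over
    the sample points into a Riemann sum. *)
Lemma lebesgue_cell c :
  lebesgue_tuple (cell c) = ((\prod_i d i 0) / (\prod_i N i)%N%:R)%:E.
Proof.
rewrite (@lebesgue_tuple_box _ _
  (fun i => grid_itv (d i 0 / (N i)%:R) (grid_index N c i))).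
  2: by move=> i; exact: measurable_itv.
transitivity (\prod_(i < n) (d i 0 / (N i)%:R)%:E)%E.
  by apply: eq_bigr => i _; exact: (lebesgue_measure_grid_itv (h_gt0 i)).
by rewrite prodEFin natr_prod prodf_div.
Qed.

Lemma cell_disjoint (a b : 'I_(\prod_i N i)%N) t : cell a t -> cell b t -> a = b.
Proof.
move=> ta tb; apply/val_inj/grid_index_inj => [||i]; [exact: ltn_ord..|].
exact: (grid_itv_disjoint (h_gt0 i) (ta i) (tb i)).
Qed.

Lemma cell_cover t : box t -> exists c : 'I_(\prod_i N i)%N, cell c t.
Proof.
rewrite boxE => /= tbox.
have /choice[z zP] : forall i, exists k, (k < N i)%N /\
    grid_itv (d i 0 / (N i)%:R) k (tnth t i).
  move=> i; have := tbox i; rewrite /= in_itv /= => ti.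
  have [||k kN tk] := @grid_itv_cover _ (d i 0 / (N i)%:R) (N i) (tnth t i).
  - exact: N_gt0.
  - by rewrite mulrC divfK// pnatr_eq0 -lt0n.
  - by exists k.
have [c cz] := grid_index_surj N_gt0 (fun i => proj1 (zP i)).
by exists c => i; rewrite cz; exact: (zP i).2.
Qed.

Lemma grid_segment_sub c i x :
  (grid_index N c i)%:R * (d i 0 / (N i)%:R) <= x ->
  x <= (grid_index N c i).+1%:R * (d i 0 / (N i)%:R) -> 0 <= x <= d i 0.
Proof.
move=> lo hi; apply/andP; split.
  by apply: le_trans lo; rewrite mulr_ge0// ltW.
apply: le_trans hi _.
rewrite mulrCA ger_pMr// ler_pdivrMr ?ltr0n// mul1r ler_nat.
exact: grid_index_lt.
Qed.

Lemma cell_sub_box c : cell c `<=` box.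
Proof.
move=> t tc; rewrite boxE => i /=; have [lo hi _] := grid_itvP (tc i).
by rewrite in_itv /=; exact: grid_segment_sub lo hi.
Qed.

End cells.

(** * Riemann sums over the grid *)

Section step_function.
Context {R : realType} {n : nat}.
Variables (d : 'cV[R]_n) (N : 'I_n -> nat).
Hypotheses (d_gt0 : forall i, 0 < d i 0) (N_gt0 : forall i, (0 < N i)%N).
Local Notation RR := (measurableTypeR R).
Local Notation box := (col_of_tuple @^-1` hyperrectangle 0 d : set (n.-tuple RR)).
Local Notation mu := (@lebesgue_tuple R n).
Variables (g : 'cV[R]_n -> R) (p : 'I_(\prod_i N i)%N -> 'cV[R]_n).

Definition step_function (t : n.-tuple RR) : R :=
  \sum_c g (p c) * \1_(cell d N c) t.

Lemma step_functionE (c : 'I_(\prod_i N i)%N) t :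
  cell d N c t -> step_function t = g (p c).
Proof.
move=> tc; rewrite /step_function (bigD1 c)//= [X in _ + X]big1 => [|c' c'c].
  by rewrite addr0 indicE mem_set// mulr1.
rewrite indicE memNset ?mulr0// => tc'.
by move/eqP: c'c; apply; exact: (cell_disjoint d_gt0 N_gt0 tc' tc).
Qed.

Lemma measurable_step_function D : measurable_fun D step_function.
Proof.
apply: measurable_sum => c; apply: measurable_funM => //.
by apply: measurable_indic; exact: measurable_cell.
Qed.

Lemma Rintegral_step_function : \int[mu]_(t in box) step_function t =
  \prod_i d i 0 * ((\prod_i N i)%N%:R^-1 * \sum_c g (p c)).
Proof.
have mB := @measurable_box R n d.
have muB : (mu box < +oo)%E by rewrite lebesgue_box// ltry.
have int1 (c : 'I_(\prod_i N i)%N) : mu.-integrable box (EFin \o \1_(cell d N c)).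
  apply: measurable_bounded_integrable => //.
    by apply: measurable_indic; exact: measurable_cell.
  exists 1; split=> // M M1 t _ /=; rewrite indicE ger0_norm ?ler0n//.
  by rewrite (le_trans _ (ltW M1))// lern1 leq_b1.
rewrite /Rintegral; under eq_integral do rewrite /step_function -sumEFin.
rewrite integral_sum//= => [|c]; last first.
  have := integrableZl mB (g (p c)) (int1 c).
  by apply: eq_integrable.
rewrite (eq_bigr (fun c => (g (p c) *
    ((\prod_i d i 0) / (\prod_i N i)%N%:R))%:E)) => [|c _]; last first.
  under eq_integral do rewrite EFinM.
  rewrite integralZl//; last exact: int1.
  rewrite integral_indic//; last exact: measurable_cell.
  rewrite setIidl; last exact: cell_sub_box.
  by rewrite -[X in (_ * X)%E]/(mu _) lebesgue_cell.
by rewrite sumEFin /= -mulr_suml mulrC -mulrA.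
Qed.

(** Uniform continuity at the scale of the mesh: two points of one closed cell
    always satisfy the last condition. *)
Definition grid_oscillation_le (e : R) : Prop := forall x y,
  hyperrectangle 0 d x -> hyperrectangle 0 d y ->
  (forall i, `|x i 0 - y i 0| <= d i 0 / (N i)%:R) -> `|g x - g y| <= e.

Definition in_closed_cells : Prop := forall (c : 'I_(\prod_i N i)%N) i,
  (grid_index N c i)%:R * (d i 0 / (N i)%:R) <= p c i 0
    <= (grid_index N c i).+1%:R * (d i 0 / (N i)%:R).

Lemma in_closed_cells_box c : in_closed_cells -> hyperrectangle 0 d (p c).
Proof.
move=> /(_ c) pc i; have /andP[lo hi] := pc i.
by rewrite mxE add0r; exact: grid_segment_sub lo hi.
Qed.

Lemma step_function_close e t : in_closed_cells -> grid_oscillation_le e ->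
  box t -> `|g (col_of_tuple t) - step_function t| <= e.
Proof.
move=> pP osc Bt; have [c tc] := cell_cover N_gt0 Bt.
rewrite (step_functionE tc); apply: osc => //; first exact: in_closed_cells_box.
move=> i; rewrite mxE; have [lo hi _] := grid_itvP (tc i).
have /andP[plo phi] := pP c i.
move: lo hi plo phi; rewrite -natr1 mulrDl mul1r.
set h := d i 0 / _; set z := _ * h => lo hi plo phi.
by rewrite ler_norml; apply/andP; split; lra.
Qed.

End step_function.

Section riemann_sums.
Context {R : realType} {n : nat}.
Variables (d : 'cV[R]_n) (d_gt0 : forall i, 0 < d i 0).
Local Notation RR := (measurableTypeR R).
Local Notation box := (col_of_tuple @^-1` hyperrectangle 0 d : set (n.-tuple RR)).
Local Notation mu := (@lebesgue_tuple R n).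
Variable g : 'cV[R]_n -> R.
Hypothesis g_osc : forall e, 0 < e ->
  \forall N \near @all_oo n, grid_oscillation_le d N g e.

Lemma all_oo_gt0 : \forall N \near @all_oo n, forall i, (0 < N i)%N.
Proof. by exists 1%N. Qed.

(* Some choice of sample points is needed to build step functions for the
   measurability and the boundedness of [g]. *)
Let corner (N : 'I_n -> nat) (c : 'I_(\prod_i N i)%N) : 'cV[R]_n :=
  \col_i ((grid_index N c i)%:R * (d i 0 / (N i)%:R)).

Let corner_in N : (forall i, (0 < N i)%N) -> in_closed_cells d (@corner N).
Proof.
move=> N0 c i; rewrite mxE lexx /= ler_wpM2r ?ler_nat//.
by rewrite divr_ge0// ltW.
Qed.

(* The step functions on the cubic grids with m + 1 intervals per axis converge
   to [g] pointwise on the box. *)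
Let measurable_g : measurable_fun box (g \o col_of_tuple).
Proof.
apply: (@measurable_fun_cvg _ _ _ _
  (fun m => step_function d g (@corner (fun=> m.+1)))) => [m|t Bt].
  exact: measurable_step_function.
apply/cvgrPdist_le => e e0; have [m _ mP] := g_osc e0.
exists m => // k /= mk; apply: step_function_close => //.
  exact: corner_in.
by apply: mP => i /=; exact: leqW.
Qed.

Lemma integrable_box : mu.-integrable box (EFin \o (g \o col_of_tuple)).
Proof.
have muB : (mu box < +oo)%E by rewrite lebesgue_box// ltry.
apply: measurable_bounded_integrable => //; first exact: measurable_box.
have [N [N0 osc]] := filter_ex (filterI all_oo_gt0 (g_osc ltr01)).
exists (\sum_c `|g (@corner N c)| + 1); split; first exact: num_real.
move=> M BM t Bt; apply: le_trans (ltW BM).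
have [c tc] := cell_cover N0 Bt.
have := step_function_close d_gt0 N0 (corner_in N0) osc Bt.
rewrite (step_functionE d_gt0 N0 _ _ tc) => gc.
rewrite -[X in `|X|](subrK (g (corner c))) addrC.
apply: le_trans (ler_normD _ _) _; rewrite lerD//.
by rewrite (bigD1 c)//= lerDl sumr_ge0.
Qed.

(** The Riemann sum is the integral of a step function that is uniformly close
    to [g] on the box. *)
Lemma riemann_sum_error N (p : 'I_(\prod_i N i)%N -> 'cV[R]_n) e :
  (forall i, (0 < N i)%N) ->
  in_closed_cells d p -> grid_oscillation_le d N g e ->
  `|(\prod_i N i)%N%:R^-1 * \sum_c g (p c) -
    (\prod_i d i 0)^-1 * \int[mu]_(t in box) g (col_of_tuple t)| <= e.
Proof.
move=> N0 pP osc; set V := \prod_i d i 0.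
have V0 : 0 < V by apply: prodr_gt0.
have mB := @measurable_box R n d.
have muB : (mu box < +oo)%E by rewrite lebesgue_box// ltry.
have iG := integrable_box.
set s := step_function d g p.
have iS : mu.-integrable box (EFin \o s).
  apply: measurable_bounded_integrable => //.
    exact: measurable_step_function.
  exists (\sum_c `|g (p c)|); split; first exact: num_real.
  move=> M BM t Bt; apply: le_trans (ltW BM); have [c tc] := cell_cover N0 Bt.
  by rewrite /s /= (step_functionE d_gt0 N0 _ _ tc) (bigD1 c)//= lerDl sumr_ge0.
have -> : (\prod_i N i)%N%:R^-1 * \sum_c g (p c) = V^-1 * \int[mu]_(t in box) s t.
  by rewrite Rintegral_step_function// mulKf// gt_eqF.
rewrite -mulrBr normrM gtr0_norm ?invr_gt0// mulrC ler_pdivrMr// distrC.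
rewrite -RintegralB//.
apply: (le_trans (le_normr_Rintegral mB (integrableB mB iG iS))).
have -> : e * V = \int[mu]_(t in box) e.
  rewrite Rintegral_cst//; congr (_ * _).
  exact/esym/(congr1 fine (lebesgue_box d_gt0)).
apply: le_Rintegral => //.
- exact: (integrable_norm (integrableB mB iG iS)).
- apply: measurable_bounded_integrable => //; exists `|e|; split=> // M eM t _.
  exact: ltW.
- by move=> t Bt; exact: step_function_close.
Qed.

Lemma riemann_sum_cvg (p : forall N, 'I_(\prod_i N i)%N -> 'cV[R]_n) :
  (\forall N \near @all_oo n, in_closed_cells d (p N)) ->
  (\prod_i N i)%N%:R^-1 * \sum_c g (p N c) @[N --> @all_oo n] -->
  (\prod_i d i 0)^-1 * \int[mu]_(t in box) g (col_of_tuple t).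
Proof.
move=> pP; apply/cvgrPdist_le => e e0; near=> N.
rewrite distrC; apply: riemann_sum_error.
- by near: N; exact: all_oo_gt0.
- by near: N.
- by near: N; exact: g_osc.
Unshelve. all: by end_near. Qed.

End riemann_sums.

(** * Uniform continuity on the box *)

Section uniform_continuity.
Context {R : realType} {n : nat}.
Implicit Types d x y : 'cV[R]_n.

Lemma trmx_continuous m k : continuous (@trmx R m k).
Proof.
move=> x A [P xP PA]; exists (fun i j => P j i) => [i j|y xy].
  by have := xP j i; rewrite mxE.
by apply: PA => i j; rewrite mxE; exact: xy.
Qed.

Lemma hyperrectangle_compact d : compact (hyperrectangle 0 d).
Proof.
have -> : hyperrectangle 0 d = trmx @`
    [set v : 'rV[R]_n | forall i, `[0, d i 0]%classic (v ord0 i)].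
  apply/seteqP; split => [x xd|_ [v vd <-] i].
    exists x^T; last by rewrite trmxK.
    by move=> i; have := xd i; rewrite /= !mxE add0r in_itv.
  by have := vd i; rewrite /= !mxE add0r in_itv.
apply: continuous_compact.
  by apply: continuous_subspaceT => x; exact: trmx_continuous.
apply: (@rV_compact _ _ (fun i => `[0, d i 0]%classic)) => i.
exact: segment_compact.
Qed.

Lemma near_all_oo_mesh d e : 0 < e ->
  \forall N \near @all_oo n, forall i, d i 0 / (N i)%:R < e.
Proof.
move=> e0; pose m := (\max_i Num.bound `|(d i 0 / e)%R|).+1.
exists m => // N /= mN i.
have N0 : (0 < N i)%N by rewrite (leq_trans _ (mN i)).
rewrite ltr_pdivrMr ?ltr0n// mulrC -ltr_pdivrMr//.
apply: le_lt_trans (ler_norm _) _.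
apply: lt_le_trans (archi_boundP (normr_ge0 _)) _.
rewrite ler_nat; apply: leq_trans (mN i); apply: leqW.
exact: leq_bigmax.
Qed.

(** Heine's theorem: a neighbourhood of each point of the box works together
    with all fine grids, and the box is compact. *)
Lemma continuous_grid_oscillation d (g : 'cV[R]_n -> R) :
  (forall x, hyperrectangle 0 d x -> {for x, continuous g}) ->
  forall e, 0 < e -> \forall N \near @all_oo n, grid_oscillation_le d N g e.
Proof.
move=> g_cont e e0.
have /compact_near_coveringP/(_ _ (@all_oo n) (fun N x => forall y,
    (forall i, `|x i 0 - y i 0| <= d i 0 / (N i)%:R) -> `|g x - g y| <= e)) :=
  @hyperrectangle_compact d.
move=> /(_ _ _)[].
  move=> x xd.
  have /cvgrPdist_lt /(_ _ (divr_gt0 e0 (ltr0n _ 2))) := g_cont x xd.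
  move=> /nbhs_ballP[r /= r0 rP].
  have r20 : 0 < r / 2 by rewrite divr_gt0.
  near=> x' N => y x'y.
  have mesh i : d i 0 / (N i)%:R < r / 2.
    by move: i; near: N; exact: near_all_oo_mesh.
  have xx' : ball x (r / 2) x'. by near: x'; exact: nbhsx_ballx.
  have {}x'y : ball x' (r / 2) y.
    split=> // i j; rewrite (ord1 j) /ball /=.
    exact: le_lt_trans (x'y i) (mesh i).
  have xy : ball x r y by rewrite (splitr r); exact: ball_triangle xx' x'y.
  have {xx'}xx' : ball x r x'.
    by apply: le_ball xx'; rewrite ler_pdivrMr// ler_peMr ?(ltW r0)// ler1n.
  rewrite (le_trans (ler_distD (g x) _ _))// [leRHS]splitr lerD//.
    by rewrite distrC ltW// rP.
  by rewrite ltW// rP.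
move=> m _ H; exists m => // N mN x y xd yd xy; exact: (H N mN x xd).
Unshelve. all: by end_near. Qed.

Lemma sample_matrix_in_closed_cells d N (M : 'M[R]_(n, (\prod_i N i)%N)) :
  (forall i, 0 < d i 0) ->
  (forall i c, 0 <= M i c <= 1) ->
  in_closed_cells d (fun c => col c (sample_matrix d M)).
Proof.
move=> d0 M01 c i; rewrite mxE sample_matrixE [_ / _ * _]mulrC.
have /andP[m0 m1] := M01 i c.
have h0 : 0 <= d i 0 / (N i)%:R by rewrite divr_ge0// ltW.
by apply/andP; split; apply: ler_wpM2r => //; rewrite -natr1; lra.
Qed.

End uniform_continuity.

(** * The limit of the Gram matrix *)

Section gram_limit.
Context {R : realType}.

Lemma cvgr_prod T (F : set_system T) {FF : Filter F} (I : finType)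
    (f : I -> T -> R) (l : I -> R) :
  (forall i, f i x @[x --> F] --> l i) ->
  \prod_i f i x @[x --> F] --> \prod_i l i.
Proof. by move=> fl; apply: (cvg_big mul_continuous) => i _; exact: fl. Qed.

Lemma cvgr_sum T (F : set_system T) {FF : Filter F} (I : finType)
    (f : I -> T -> R) (l : I -> R) :
  (forall i, f i x @[x --> F] --> l i) ->
  \sum_i f i x @[x --> F] --> \sum_i l i.
Proof. by move=> fl; apply: (cvg_big add_continuous) => i _; exact: fl. Qed.

Lemma sum_midpoint m : \sum_(k < m) (k.+1%:R - 1/2 : R) = m%:R ^+ 2 / 2.
Proof.
elim: m => [|m IH]; first by rewrite big_ord0 expr0n /= mul0r.
by rewrite big_ord_recr /= IH -natr1; field.
Qed.

Lemma sum_sqr_midpoint m :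
  \sum_(k < m) (k.+1%:R - 1/2 : R) ^+ 2 = m%:R ^+ 3 / 3 - m%:R / 12.
Proof.
elim: m => [|m IH]; first by rewrite big_ord0 expr0n /= !mul0r subr0.
by rewrite big_ord_recr /= IH -natr1; field.
Qed.

(** The midpoint rule is exact in degree at most one, and misses a multiple of
    the squared mesh in degree two. *)
Lemma midpoint_moment (a : R) e m : (e <= 2)%N -> (0 < m)%N ->
  m%:R^-1 * \sum_(k < m) (a / m%:R * (k.+1%:R - 1/2)) ^+ e =
  a ^+ e / e.+1%:R - a ^+ e * (e == 2)%:R / 12 * m%:R^-1 ^+ 2.
Proof.
move=> e2 m0; have m1 : m%:R != 0 :> R by rewrite pnatr_eq0 -lt0n.
under eq_bigr do rewrite exprMn; rewrite -mulr_sumr.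
case: e e2 => [|[|[|//]]] _ /=.
- under eq_bigr do rewrite expr0.
  by rewrite sumr_const card_ord; field.
- by under eq_bigr do rewrite expr1; rewrite sum_midpoint; field.
- by rewrite sum_sqr_midpoint; field.
Qed.

Lemma cvg_all_oo_inv n (i : 'I_n) : (N i)%:R^-1 @[N --> @all_oo n] --> (0 : R).
Proof.
apply/cvgr0Pnorm_lt => e e0.
have := @near_all_oo_mesh R n (const_mx 1) e e0.
by apply: filterS => N /(_ i); rewrite mxE mul1r ger0_norm// invr_ge0.
Qed.

Lemma midpoint_moment_cvg n (i : 'I_n) (a : R) e : (e <= 2)%N ->
  (N i)%:R^-1 * \sum_(k < N i) (a / (N i)%:R * (k.+1%:R - 1/2)) ^+ e
    @[N --> @all_oo n] --> a ^+ e / e.+1%:R.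
Proof.
move=> e2.
have lim : a ^+ e / e.+1%:R - a ^+ e * (e == 2)%:R / 12 * (N i)%:R^-1 ^+ 2
    @[N --> @all_oo n] --> a ^+ e / e.+1%:R.
  rewrite -[X in _ --> X]subr0; apply: cvgB; first exact: cvg_cst.
  rewrite -(mulr0 (a ^+ e * (e == 2)%:R / 12)); apply: cvgM; first exact: cvg_cst.
  rewrite -(mulr0 (0 : R)) /=.
  by apply: (cvgM (@cvg_all_oo_inv n i) (@cvg_all_oo_inv n i)).
apply: cvg_trans lim; apply: near_eq_cvg; near=> N.
rewrite midpoint_moment//; near: N.
by apply: filterS (@all_oo_gt0 n) => N /(_ i).
Unshelve. all: by end_near. Qed.

Lemma prod_expr_delta (I : finType) (x : I -> R) i :
  \prod_k x k ^+ (k == i) = x i.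
Proof.
rewrite (bigD1 i)//= eqxx expr1 big1 ?mulr1// => k /negPf->.
by rewrite expr0.
Qed.

Variables (n : nat) (d : 'cV[R]_n) (d_gt0 : forall i, 0 < d i 0).
Local Notation gram N S := ((\prod_i N i)%N%:R^-1 *: (S *m S^T)).

(** Entrywise the mean value of x_i x_j over the box. *)
Definition gram_lim : 'M[R]_n :=
  \matrix_(i, j) (d i 0 * d j 0 / (if i == j then 3 else 4)).

Lemma gramE (N : 'I_n -> nat) (S : 'M[R]_(n, (\prod_i N i)%N)) i j :
  gram N S i j = (\prod_i N i)%N%:R^-1 * \sum_c (col c S) i 0 * (col c S) j 0.
Proof.
rewrite !mxE; congr (_ * _); apply: eq_bigr => c _.
by rewrite !mxE.
Qed.

Let midpoints N :=
  sample_matrix d (const_mx (1/2) : 'M[R]_(n, (\prod_i N i)%N)).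

(** At the cell centres x_i x_j is the product over the axes k of the
    coordinates x_k to the power (k == i) + (k == j), whose average factors into
    one-dimensional moments. Each factor tends to the mean of a power on
    [0, d_k], which treats the cases i = j and i <> j together. *)
Lemma gram_midpoint_cvg i j :
  (\prod_i N i)%N%:R^-1 *
    \sum_c (col c (midpoints N)) i 0 * (col c (midpoints N)) j 0
    @[N --> @all_oo n] --> gram_lim i j.
Proof.
pose e (k : 'I_n) := ((k == i) + (k == j))%N.
have -> : gram_lim i j = \prod_k (d k 0 ^+ e k / (e k).+1%:R).
  rewrite mxE /e; have [<-|ij] := eqVneq i j.
    rewrite (bigD1 i)//= big1 => [|k /negPf->]; last by rewrite expr0 divr1.
    by rewrite eqxx mulr1 expr2.
  rewrite (bigD1 i)//= (bigD1 j) 1?eq_sym//=.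
  rewrite big1 => [|k /andP[/negPf-> /negPf->]].
    rewrite !eqxx eq_sym (negPf ij) /= !expr1 mulr1 mulrACA -invfM.
    by congr (_ / _); rewrite -natrM.
  by rewrite expr0 divr1.
have e2 k : (e k <= 2)%N by rewrite /e; case: eqP; case: eqP.
apply: cvg_trans (cvgr_prod
  (fun k => @midpoint_moment_cvg n k (d k 0) (e k) (e2 k))).
apply: near_eq_cvg; near=> N.
rewrite big_split /= prodfV -natr_prod.
rewrite -(@sum_grid_prod n N _ _ (fun k m =>
  (d k 0 / (N k)%:R * (m.+1%:R - 1/2)) ^+ e k)); last first.
  by near: N; exact: all_oo_gt0.
congr (_ * _); apply: eq_bigr => c _.
rewrite ![col _ _ _ _]mxE /midpoints !sample_matrixE !mxE.
under eq_bigr do rewrite exprD.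
by rewrite big_split /= !prod_expr_delta.
Unshelve. all: by end_near. Qed.

Lemma coord_prod_continuous i j : continuous (fun x : 'cV[R]_n => x i 0 * x j 0).
Proof.
move=> x.
exact: (cvgM (@coord_continuous R n 1 i 0 x) (@coord_continuous R n 1 j 0 x)).
Qed.

(** The Riemann sums of x_i x_j have the same limit for all sample points, hence
    the limit found for the cell centres. *)
Lemma gram_cvg (M : forall N : 'I_n -> nat, 'M[R]_(n, (\prod_i N i)%N)) i j :
  (\forall N \near @all_oo n, forall i c, 0 <= M N i c <= 1) ->
  gram N (sample_matrix d (M N)) i j @[N --> @all_oo n] --> gram_lim i j.
Proof.
move=> M01.
have osc := @continuous_grid_oscillation R n d _
  (fun x _ => @coord_prod_continuous i j x).
have lim (M' : forall N, 'M[R]_(n, (\prod_i N i)%N)) M'01 :=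
  riemann_sum_cvg d_gt0 osc (filterS
  (fun N => @sample_matrix_in_closed_cells R n d N (M' N) d_gt0) M'01).
have mid01 : \forall N \near @all_oo n, forall i (c : 'I_(\prod_i N i)%N),
    0 <= (const_mx (1/2) : 'M[R]_(n, (\prod_i N i)%N)) i c <= 1.
  by apply: nearW => N k c; rewrite mxE; lra.
under eq_fun do rewrite gramE.
rewrite (cvg_unique (@Rhausdorff R) (@gram_midpoint_cvg i j) (lim _ _ mid01)).
exact: lim.
Qed.

End gram_limit.

(** * Normal equations and passage to the limit *)

Section normal_equations.
Context {R : realType}.

Lemma cvg_col T (F : set_system T) {FF : Filter F} n (x : T -> 'cV[R]_n)
    (v : 'cV[R]_n) :
  (forall i, x t i 0 @[t --> F] --> v i 0) -> x t @[t --> F] --> v.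
Proof.
move=> xv B [P vP PB].
have : \forall t \near F, forall i, P i 0 (x t i 0).
  by apply: filter_forall => i; exact: xv (vP i 0).
by apply: filterS => t xP; apply: PB => i j; rewrite (ord1 j).
Qed.

(** The product (S S^T) (S^+)^T is S (S^+ S)^T = S S^+ S = S. The equations hold
    whatever the rank of S, hence also on coarse grids, where S S^T may be
    singular. *)
Lemma gsg_normal_equations n (f : 'cV[R]_n -> R) x0 p (S : 'M[R]_(n, p)) :
  S *m S^T *m gsg f x0 S = S *m delta f x0 S.
Proof.
have [SXS _ _ XS] := moore_penroseP S.
by rewrite /gsg mulmxA -(mulmxA S) -trmx_mul XS mulmxA SXS.
Qed.

Lemma mx_L_gram_lim n (d : 'cV[R]_n) : (forall i, 0 < d i 0) ->
  mx_L d *m gram_lim d = 1%:M.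
Proof.
move=> d_gt0; apply/matrixP => i k; rewrite !mxE.
have d0 j : d j 0 != 0 by rewrite gt_eqF.
have n0 : 3 * n%:R + 1 != 0 :> R by rewrite gt_eqF// ltr_wpDl// mulr_ge0.
pose a : R := 36 / (3 * n%:R + 1).
(* With D the diagonal matrix of d, [mx_L d] = D^-1 (12 - a J) D^-1 and
   [gram_lim d] = D (J / 4 + 1 / 12) D; each term of the product is expanded in
   Kronecker symbols. *)
rewrite (eq_bigr (fun j => d k 0 / d i 0 *
  (3 * (i == j)%:R + (i == j)%:R * (j == k)%:R - a / 4 - a / 12 * (j == k)%:R))).
  2: {
  move=> j _; rewrite !mxE /a.
  by case: (eqVneq i j) => [<-|_]; case: eqVneq => [<-|_] /=; field;
    rewrite ?d0 ?n0. }
rewrite -mulr_sumr !sumrB big_split /= -!mulr_sumr sumr_const card_ord.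
have delta_l (g : 'I_n -> R) : \sum_j (i == j)%:R * g j = g i.
  rewrite (bigD1 i)//= eqxx mul1r big1 ?addr0// => j /negPf.
  by rewrite eq_sym => ->; rewrite mul0r.
have delta1 : \sum_(j < n) (i == j)%:R = 1 :> R.
  by rewrite -[RHS](delta_l (fun=> 1)); under [RHS]eq_bigr do rewrite mulr1.
have delta2 : \sum_(j < n) (j == k)%:R = 1 :> R.
  rewrite (bigD1 k)//= eqxx big1 ?addr0// => j /negPf.
  by move=> ->.
rewrite delta_l delta1 delta2 -mulr_natr /a.
by case: eqVneq => [<-|_] /=; field; rewrite ?d0 ?n0.
Qed.

(** The solution satisfies x = L b + (1 - L A) x with 1 - L A tending to 0. Once
    the entries of 1 - L A have sum at most 1/2, the l1 norm of x is at most twice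
    that of L b, so the last term tends to 0. *)
Lemma cvg_linear_system T (F : set_system T) {FF : Filter F} n
    (A : T -> 'M[R]_n) (b x : T -> 'cV[R]_n) (L G : 'M[R]_n) (v : 'cV[R]_n) :
  L *m G = 1%:M ->
  (forall i j, A t i j @[t --> F] --> G i j) ->
  (forall i, b t i 0 @[t --> F] --> v i 0) ->
  (\forall t \near F, A t *m x t = b t) ->
  forall i, x t i 0 @[t --> F] --> (L *m v) i 0.
Proof.
move=> LG AG bv Axb i.
pose w t := L *m b t; pose E t := 1%:M - L *m A t.
pose e t : R := \sum_i \sum_j `|E t i j|.
pose s t : R := \sum_i `|w t i 0|.
have wv k : w t k 0 @[t --> F] --> (L *m v) k 0.
  rewrite mxE; under eq_fun do rewrite mxE.
  by apply: cvgr_sum => j; apply: cvgM; [exact: cvg_cst|exact: bv].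
have E0 k l : E t k l @[t --> F] --> (0 : R).
  have -> : 0 = (k == l)%:R - \sum_j L k j * G j l :> R.
    by have /matrixP/(_ k l) := LG; rewrite !mxE => ->; rewrite subrr.
  under eq_fun do rewrite !mxE.
  apply: cvgB; first exact: cvg_cst.
  by apply: cvgr_sum => j; apply: cvgM; [exact: cvg_cst|exact: AG].
have e0 : e t @[t --> F] --> (0 : R).
  have -> : 0 = \sum_(i < n) \sum_(j < n) `|0 : R|.
    by rewrite big1// => k _; rewrite big1// => l _; rewrite normr0.
  by do 2 apply: cvgr_sum => ?; apply: cvg_norm; exact: E0.
have ss : s t @[t --> F] --> \sum_i `|(L *m v) i 0|.
  by apply: cvgr_sum => k; apply: cvg_norm; exact: wv.
have xw : x t i 0 - w t i 0 @[t --> F] --> (0 : R).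
  apply: norm_cvg0.
  have es0 : 2 * e t * s t @[t --> F] --> (0 : R).
    rewrite -(mul0r (\sum_i `|(L *m v) i 0|)); apply: cvgM => //.
    by rewrite -(mulr0 2); apply: cvgM => //; exact: cvg_cst.
  apply: (squeeze_cvgr _ (cvg_cst 0) es0); near=> t.
  rewrite normr_ge0 /=.
  have Axbt : A t *m x t = b t by near: t.
  have et : e t <= 1/2.
    apply: le_trans (ler_norm _) _; near: t.
    by apply: (cvgr0_norm_le _ e0); rewrite divr_gt0.
  have xE : x t - w t = E t *m x t.
    by rewrite /E /w mulmxBl mul1mx -mulmxA Axbt.
  have xwk k : `|x t k 0 - w t k 0| <= \sum_j `|E t k j| * `|x t j 0|.
    have -> : x t k 0 - w t k 0 = (E t *m x t) k 0 by rewrite -xE !mxE.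
    rewrite mxE; apply: le_trans (ler_norm_sum _ _ _) _.
    by apply: ler_sum => j _; rewrite normrM.
  pose X := \sum_k `|x t k 0|.
  have X0 : 0 <= X by apply: sumr_ge0.
  have EX : \sum_k \sum_j `|E t k j| * `|x t j 0| <= e t * X.
    rewrite /e mulr_suml; apply: ler_sum => k _.
    rewrite mulr_suml; apply: ler_sum => j _; rewrite ler_wpM2l//.
    by rewrite /X (bigD1 j)//= lerDl sumr_ge0.
  have Xs : X <= s t + e t * X.
    apply: le_trans (lerD (lexx (s t)) EX); rewrite /s -big_split /=.
    apply: ler_sum => k _; rewrite -lerBlDl.
    exact: le_trans (lerB_dist _ _) (xwk k).
  (* Since [e t] is at most 1/2, the term [e t * X] can be absorbed. *)
  have {}Xs : X <= 2 * s t by nra.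
  have e_ge0 : 0 <= e t by do 2 apply: sumr_ge0 => ? _.
  apply: (le_trans (xwk i)); apply: le_trans (_ : e t * X <= _); last by nra.
  apply: le_trans EX; rewrite [leRHS](bigD1 i)//= lerDl.
  by do 2 (apply: sumr_ge0 => ? _); rewrite mulr_ge0.
have -> : (fun t => x t i 0) = (fun t => (x t i 0 - w t i 0) + w t i 0).
  by apply/funext => t; rewrite subrK.
by rewrite -(add0r ((L *m v) i 0)); apply: cvgD.
Unshelve. all: by end_near. Qed.

End normal_equations.

Theorem theorem3p9 (R : realType) (n : nat) (n_ge2 : (2 <= n)%N)
  (d x0 : 'cV[R]_n) (d_gt0 : forall i, 0 < d i 0)
  (f : 'cV[R]_n -> R) (U : set 'cV[R]_n) (U_open : open U)
  (box_sub : hyperrectangle x0 d `<=` U) (f_cont : {within U, continuous f})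
  (M : forall N : 'I_n -> nat, 'M[R]_(n, (\prod_i N i)%N))
  (M_01 : forall N : 'I_n -> nat, (forall i, (2 <= N i)%N) ->
    forall i c, 0 <= M N i c <= 1) :
  gsg f x0 (sample_matrix d (M N)) @[N --> @all_oo n] -->
    (\prod_i d i 0)^-1 *: (mx_L d *m vec_T f x0 d).
Proof.
have M01 : \forall N \near @all_oo n, forall i c, 0 <= M N i c <= 1.
  by exists 2%N => // N /= N2; exact: M_01.
pose S N := sample_matrix d (M N).
pose g N := gsg f x0 (S N).
pose b N := (\prod_i N i)%N%:R^-1 *: (S N *m delta f x0 (S N)).
pose v := (\prod_i d i 0)^-1 *: vec_T f x0 d.
have hcont i x : hyperrectangle 0 d x ->
    {for x, continuous (fun x : 'cV[R]_n => x i 0 * (f (x0 + x) - f x0))}.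
  move=> xd.
  have Ux : U (x0 + x).
    by apply: box_sub => k; have := xd k; rewrite !mxE add0r lerDl lerD2l.
  have fx : {for x0 + x, continuous f}.
    by move: f_cont; rewrite continuous_open_subspace// => /(_ _ (mem_set Ux)).
  have x0x : x0 + y @[y --> x] --> x0 + x.
    exact: (cvgD (cvg_cst x0) (@cvg_id _ (nbhs x))).
  have fx0x : f (x0 + y) @[y --> x] --> f (x0 + x).
    exact: (@cvg_comp _ _ _ (fun y => x0 + y) f _ _ _ x0x fx).
  exact: (cvgM (@coord_continuous R n 1 i 0 x) (cvgB fx0x (cvg_cst (f x0)))).
have bv i : b N i 0 @[N --> @all_oo n] --> v i 0.
  have -> : v i 0 = (\prod_i d i 0)^-1 *
     \int[@lebesgue_tuple R n]_(t in col_of_tuple @^-1` hyperrectangle 0 d)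
       (fun x : 'cV[R]_n => x i 0 * (f (x0 + x) - f x0)) (col_of_tuple t).
    by rewrite !mxE.
  have -> : (fun N => b N i 0) = (fun N => (\prod_i N i)%N%:R^-1 *
      \sum_c (fun x : 'cV[R]_n => x i 0 * (f (x0 + x) - f x0)) (col c (S N))).
    apply/funext => N; rewrite !mxE; congr (_ * _).
    by apply: eq_bigr => c _; rewrite !mxE.
  apply: (@riemann_sum_cvg _ _ _ d_gt0
    (fun x : 'cV[R]_n => x i 0 * (f (x0 + x) - f x0))).
    exact: continuous_grid_oscillation (hcont i).
  apply: filterS M01 => N; exact: sample_matrix_in_closed_cells.
have gv := @cvg_linear_system R _ (@all_oo n) _ n
  (fun N => (\prod_i N i)%N%:R^-1 *: (S N *m (S N)^T)) b g (mx_L d)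
  (gram_lim d) v (mx_L_gram_lim d_gt0)
  (fun i j => @gram_cvg R n d d_gt0 M i j M01) bv.
have {gv}gv : forall i, g N i 0 @[N --> @all_oo n] --> (mx_L d *m v) i 0.
  apply: gv; apply: nearW => N.
  by rewrite -scalemxAl gsg_normal_equations.
by rewrite scalemxAr -/v; exact: cvg_col.
Qed.
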